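(* The family of lattice-face polytopes contains all combinatorial types of rational polytopes: for every $d\ge 1$ and every full-dimensional rational polytope $P \subset \mathbb{R}^d$ there is a lattice-face polytope having the same combinatorial type as $P$. More specifically, given any full-dimensional rational polytope $P \subset \mathbb{R}^d$, there exists an invertible linear transformation $\phi : \mathbb{R}^d \to \mathbb{R}^d$ such that $\phi(P)$ is a lattice-face polytope.
   Context: A polytope is the convex hull of a finite set of points; all polytopes are full-dimensional in their ambient space. A rational polytope in $\mathbb{R}^d$ is a polytope whose vertices all lie in $\mathbb{Q}^d$. The face poset of a polytope is the set of all its faces ordered by inclusion; two polytopes have the same combinatorial type if they have the same (i.e. isomorphic) face poset. $\mathrm{conv}$ and $\mathrm{aff}$ denote convex hull and affine hull. $\pi : \mathbb{R}^d \to \mathbb{R}^{d-1}$ is the map that forgets the last coordinate. For a set $S \subset \mathbb{R}^d$, $\mathcal{L}(S) = S \cap \mathbb{Z}^d$. Lattice-face polytopes are defined recursively. A $1$-dimensional polytope (in $\mathbb{R}^1$) is a lattice-face polytope if it is integral, i.e. its vertices are integers. For $d \ge 2$, a $d$-dimensional polytope $P\subset\mathbb{R}^d$ with vertex set $V$ is a lattice-face polytope if for every subset $U \subset V$ spanning a $(d-1)$-dimensional affine space: (a) $\pi(\mathrm{conv}(U))$ is a lattice-face polytope (of dimension $d-1$ in $\mathbb{R}^{d-1}$), and (b) $\pi(\mathcal{L}(\mathrm{aff}(U))) = \mathbb{Z}^{d-1}$. *)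

(* Defs.v *)
From HB Require Import structures.
From mathcomp Require Import all_boot all_order all_algebra.
From mathcomp Require Import all_classical all_reals.

Set Implicit Arguments.
Unset Strict Implicit.
Unset Printing Implicit Defensive.

Import Order.TTheory GRing.Theory Num.Theory.

Local Open Scope classical_set_scope.
Local Open Scope ring_scope.

Section Polytopes.
Context {R : realType}.

Definition conv d (S : set 'rV[R]_d) : set 'rV[R]_d :=
  [set x | exists (n : nat) (p : 'I_n -> 'rV[R]_d) (w : 'I_n -> R),
    [/\ forall i, S (p i), forall i, 0 <= w i, \sum_i w i = 1
      & x = \sum_i w i *: p i]].

Definition aff d (S : set 'rV[R]_d) : set 'rV[R]_d :=
  [set x | exists (n : nat) (p : 'I_n -> 'rV[R]_d) (w : 'I_n -> R),
    [/\ forall i, S (p i), \sum_i w i = 1 & x = \sum_i w i *: p i]].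

Definition affine_space d (k : nat) (A : set 'rV[R]_d) : Prop :=
  exists (x0 : 'rV[R]_d) (W : {vspace 'rV[R]_d}),
    \dim W = k /\ A = [set x | x - x0 \in W].

(* Full-dimensionality is part of the definition. *)
Definition polytope d (P : set 'rV[R]_d) : Prop :=
  (exists2 V : set 'rV[R]_d, finite_set V & P = conv V) /\
  affine_space d (aff P).

(* The faces include set0 (take a = 0, c = 1) and P itself (a = 0, c = 0). *)
Definition face d (P F : set 'rV[R]_d) : Prop :=
  exists (a : 'cV[R]_d) (c : R),
    (forall x, P x -> (x *m a) 0 0 <= c) /\
    F = P `&` [set x | (x *m a) 0 0 = c].

Definition vertices d (P : set 'rV[R]_d) : set 'rV[R]_d :=
  [set v | face P [set v]].

Definition rational_polytope d (P : set 'rV[R]_d) : Prop :=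
  polytope P /\
  forall v, vertices P v -> forall j, exists q : rat, v 0 j = ratr q.

Definition same_combinatorial_type d e
    (P : set 'rV[R]_d) (Q : set 'rV[R]_e) : Prop :=
  exists f : set 'rV[R]_d -> set 'rV[R]_e,
    set_bij [set F | face P F] [set G | face Q G] f /\
    forall F G, face P F -> face P G -> (F `<=` G <-> f F `<=` f G).

Definition lattice_points d (S : set 'rV[R]_d) : set 'rV[R]_d :=
  S `&` [set x | x \is a mxOver Num.int].

Definition forget_last d (x : 'rV[R]_d.+1) : 'rV[R]_d :=
  \row_j x 0 (widen_ord (leqnSn d) j).

(* The recursion starts in dimension 1; the value at 0 is a dummy. *)
Fixpoint lattice_face (d : nat) : set 'rV[R]_d -> Prop :=
  match d return set 'rV[R]_d -> Prop with
  | 0 => fun _ => False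
  | d'.+1 => fun P =>
    polytope P /\
    match d' with
    | 0 => forall v, vertices P v -> v \is a mxOver Num.int
    | _.+1 => forall U : set 'rV[R]_d'.+1,
        U `<=` vertices P -> affine_space d' (aff U) ->
        lattice_face (@forget_last d' @` conv U) /\
        @forget_last d' @` lattice_points (aff U) = lattice_points setT
    end
  end.

End Polytopes.

(* Main.v *)
Require Import Defs.
From mathcomp Require Import all_boot all_order all_algebra.
From mathcomp Require Import all_classical all_reals.
From mathcomp Require Import ring.

(** The definition of a lattice-face polytope unrolls along chains of vertex
sets of dimensions d - 1, d - 2, ..., each projected to one coordinate fewer.
Because these projections only forget trailing coordinates, every set met on
the way is the image of a subset U of the original vertices under the first k
coordinate functions, for some k.  All the conditions therefore follow from a
single property of a system of linear forms m 0, m 1, ... on the original space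
([lattice_coordinates]): if a set U of vertices spans a flat of dimension k,
then
- the first k forms are injective on the directions of the flat, so that the
  flat is the graph of an affine function of its first k coordinates; and
- on this graph the next form m k takes an integer value as soon as the first k
  forms do.
The second condition for k = 0 says that m 0 is integral at the vertices, which
settles dimension 1; [lattice_face_cols] carries out the induction.

Such a system exists for every finite set of rational points
([exists_lattice_coordinates]).  There are finitely many flats, so m 0, m 1,
... can be chosen rational and in general position one after the other: the
next form must not vanish on a chosen nonzero vector of what is left of each
direction space, and points of the moment curve avoid finitely many hyperplanes
([generic_columns]).  On each flat, m k is then an affine combination
q_0 + q_1 m 0 + ... + q_k m (k-1), and its coefficients can be taken rational,
since a linear system over the rationals that is solvable over the reals is
solvable over the rationals ([affine_relation]).  Let N be a common denominator
of all these coefficients, over all flats, and replace m j by N^(j+1) m j: the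
coefficient of m j in m k is multiplied by N^(k-j) and the constant one by
N^(k+1), so all become integers.

Taking k = d and U the whole vertex set, the first d forms are the coordinates
of an invertible linear map phi, and phi(P) is a lattice-face polytope.  An
invertible linear map carries supporting hyperplanes to supporting hyperplanes,
so phi(P) has the combinatorial type of P.

Only the vertices of P, in the sense of exposed points, are known to be
rational, whereas P is given as the hull of some finite set.  That P is the hull
of its vertices comes from separating a point from a polytope, which is Farkas'
lemma ([farkas], [conv_seq_vertices]). *)

Set Implicit Arguments.
Unset Strict Implicit.
Unset Printing Implicit Defensive.

Import Order.TTheory GRing.Theory Num.Theory.

Local Open Scope classical_set_scope.
Local Open Scope ring_scope.

Local Notation dot x a := ((x *m a : 'M_1) 0 0).

(** * Linear forms *)

Section Dot.
Variables (R : comNzRingType) (d : nat).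
Implicit Types (x y : 'rV[R]_d) (a b : 'cV[R]_d).

Lemma dotBl x y a : dot (x - y) a = dot x a - dot y a.
Proof. by rewrite mulmxBl !mxE. Qed.

Lemma dotZl k x a : dot (k *: x) a = k * dot x a.
Proof. by rewrite -scalemxAl mxE. Qed.

Lemma dotBr x a b : dot x (a - b) = dot x a - dot x b.
Proof. by rewrite mulmxBr !mxE. Qed.

Lemma dotZr k x a : dot x (k *: a) = k * dot x a.
Proof. by rewrite -scalemxAr mxE. Qed.

Lemma dot_suml (I : finType) (F : I -> 'rV[R]_d) a :
  dot (\sum_i F i) a = \sum_i dot (F i) a.
Proof. by rewrite mulmx_suml summxE. Qed.

Lemma dot_delta x j : dot x (delta_mx j 0 : 'cV_d) = x 0 j.
Proof. by rewrite -colE mxE. Qed.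

End Dot.

(** * Convex and affine hulls *)

Section Hull.
Context {R : realType}.

(** Convex and affine hulls differ only in the weights they allow, so that they
share the facts about combinations of combinations and about linear images. *)
Definition hull (K : set R) d (S : set 'rV[R]_d) : set 'rV[R]_d :=
  [set x | exists (n : nat) (p : 'I_n -> 'rV[R]_d) (w : 'I_n -> R),
    [/\ forall i, S (p i), forall i, K (w i), \sum_i w i = 1
      & x = \sum_i w i *: p i]].

Lemma convE d (S : set 'rV[R]_d) : conv S = hull [set w | 0 <= w] S.
Proof. by []. Qed.

Lemma affE d (S : set 'rV[R]_d) : aff S = hull setT S.
Proof.
by apply/seteqP; split=> x [n [p [w]]]; [case=> ? ? ? | case=> ? _ ? ?];
  exists n, p, w.
Qed.

Variable (K : set R).

Lemma hull_fin d (S : set 'rV[R]_d) (I : finType) (p : I -> 'rV[R]_d)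
    (w : I -> R) :
  (forall i, S (p i)) -> (forall i, K (w i)) -> \sum_i w i = 1 ->
  hull K S (\sum_i w i *: p i).
Proof.
move=> Sp Kw w1; exists #|I|, (p \o enum_val), (w \o enum_val); split=> //=.
- by rewrite -w1 -(big_enum_val w).
- by rewrite -(big_enum_val (fun i => w i *: p i)).
Qed.

Lemma hull_mono d (S T : set 'rV[R]_d) : S `<=` T -> hull K S `<=` hull K T.
Proof.
move=> ST x [n [p [w [Sp Kw w1 xE]]]].
by exists n, p, w; split=> // i; apply: ST.
Qed.

Lemma sub_hull d (S : set 'rV[R]_d) : K 1 -> S `<=` hull K S.
Proof.
move=> K1 x Sx; exists 1%N, (fun=> x), (fun=> 1).
by split=> //; rewrite big_ord1 ?scale1r.
Qed.

(** A combination of combinations is a combination indexed by the pairs of an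
outer and an inner index, with products as weights. *)
Lemma hull_idem d (S : set 'rV[R]_d) :
  (forall u v, K u -> K v -> K (u * v)) -> hull K (hull K S) `<=` hull K S.
Proof.
move=> KM x [n [p [w [Sp Kw w1 ->]]]].
have choices i : {m & {q : 'I_m -> 'rV[R]_d & {u : 'I_m -> R |
    [/\ forall j, S (q j), forall j, K (u j), \sum_j u j = 1
      & p i = \sum_j u j *: q j]}}}.
  by have /cid[m /cid[q /cid[u uP]]] := Sp i; exists m, q, u.
have [m /all_tag[q /all_tag[u uP]]] := all_tag choices.
have -> : \sum_i w i *: p i = \sum_i \sum_j (w i * u i j) *: q i j.
  apply: eq_bigr => i _; have [_ _ _ ->] := uP i.
  by rewrite scaler_sumr; apply: eq_bigr => j _; rewrite scalerA.
rewrite sig_big_dep /=.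
apply: (hull_fin (p := fun k : {i : 'I_n & 'I_(m i)} => q (tag k) (tagged k))
                 (w := fun k => w (tag k) * u (tag k) (tagged k))).
- by move=> [i j]; have [+ _ _ _] := uP i; apply.
- by move=> [i j]; apply: KM => //; have [_ + _ _] := uP i; apply.
- rewrite -(sig_big_dep predT (fun _ => predT) (fun i j => w i * u i j)) /=.
  rewrite -[RHS]w1; apply: eq_bigr => i _.
  by have [_ _ u1 _] := uP i; rewrite -mulr_sumr u1 mulr1.
Qed.

Lemma hull_image d e (M : 'M[R]_(d, e)) (S : set 'rV[R]_d) :
  (fun x => x *m M) @` hull K S = hull K ((fun x => x *m M) @` S).
Proof.
apply/seteqP; split=> [_ [x [n [p [w [Sp Kw w1 ->]]]] <-]|].
  exists n, (fun i => p i *m M), w; split=> //.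
    by move=> i; exists (p i).
  by rewrite mulmx_suml; apply: eq_bigr => i _; rewrite scalemxAl.
move=> y [n [p [w [Sp Kw w1 ->]]]].
have [q qP] := choice (fun i => let: ex_intro2 x Sx xE := Sp i in
  ex_intro (fun x => S x /\ x *m M = p i) x (conj Sx xE)).
exists (\sum_i w i *: q i).
  by exists n, q, w; split=> // i; case: (qP i).
rewrite mulmx_suml; apply: eq_bigr => i _.
by case: (qP i) => _ <-; rewrite scalemxAl.
Qed.

End Hull.

Section ConvAff.
Context {R : realType}.
Implicit Types (d : nat).

Lemma sub_conv d (S : set 'rV[R]_d) : S `<=` conv S.
Proof. by rewrite convE; apply: sub_hull => /=; exact: ler01. Qed.

Lemma sub_aff d (S : set 'rV[R]_d) : S `<=` aff S.
Proof. by rewrite affE; exact: sub_hull. Qed.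

Lemma aff_conv d (S : set 'rV[R]_d) : aff (conv S) = aff S.
Proof.
rewrite !affE; apply/seteqP; split; last exact/hull_mono/sub_conv.
apply: subset_trans (hull_idem (fun _ _ _ _ => I)); apply: hull_mono.
by move=> x [n [p [w [Sp _ w1 ->]]]]; exists n, p, w.
Qed.

Lemma conv_absorb d (S T : set 'rV[R]_d) :
  S `<=` T -> T `<=` conv S -> conv T = conv S.
Proof.
rewrite !convE => ST TS; apply/seteqP; split; last exact: hull_mono.
apply: (subset_trans (hull_mono TS)).
by apply: hull_idem => u v /=; exact: mulr_ge0.
Qed.

Lemma conv_image d e (M : 'M[R]_(d, e)) (S : set 'rV[R]_d) :
  (fun x => x *m M) @` conv S = conv ((fun x => x *m M) @` S).
Proof. by rewrite !convE hull_image. Qed.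

Lemma aff_image d e (M : 'M[R]_(d, e)) (S : set 'rV[R]_d) :
  (fun x => x *m M) @` aff S = aff ((fun x => x *m M) @` S).
Proof. by rewrite !affE hull_image. Qed.

End ConvAff.

(** * Separation, and polytopes as hulls of their vertices *)

Section Separation.

(** Induction on the number of generators.  If a form a separates v from all the
generators but the last one, h, and is positive on h, then project along h onto
the kernel of a.  If the projection of v lies in the cone of the projected
generators, then lifting back gives v with a coefficient at h that is
nonnegative because a is positive at v and nonpositive at the other generators.
Otherwise a form b separates the projections, and b corrected by a multiple of a
so as to vanish on h separates v itself. *)
Lemma farkas (R : realFieldType) d n (g : 'I_n -> 'rV[R]_d) (v : 'rV[R]_d) :
  (exists2 w, forall i, 0 <= w i & v = \sum_i w i *: g i) \/
  (exists2 a, 0 < dot v a & forall i, dot (g i) a <= 0).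
Proof.
elim: n => [|n IHn] in g v *.
  have [->|v0] := eqVneq v 0.
    by left; exists (fun=> 0) => //; rewrite big_ord0.
  have /rV0Pn[j vj] := v0.
  right; exists (v 0 j *: (delta_mx j 0 : 'cV_d)); last by case.
  by rewrite dotZr dot_delta -expr2 exprn_even_gt0.
have widE i : widen_ord (leqnSn n) i = lift ord_max i.
  exact/val_inj/esym/lift_max.
have splitI (Q : 'I_n.+1 -> Prop) :
    (forall i, Q (lift ord_max i)) -> Q ord_max -> forall i, Q i.
  by move=> Qw Qm i; case: (unliftP ord_max i) => [j ->|->].
pose g' (i : 'I_n) := g (lift ord_max i); pose h := g ord_max.
pose ext (w : 'I_n -> R) m (i : 'I_n.+1) :=
  if unlift ord_max i is Some j then w j else m.
have sum_ext (w : 'I_n -> R) m :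
    \sum_i ext w m i *: g i = \sum_i w i *: g' i + m *: h.
  rewrite big_ord_recr /= {2}/ext unlift_none; congr (_ + _).
  by apply: eq_bigr => i _; rewrite widE /ext liftK.
have ext_ge0 (w : 'I_n -> R) m :
    (forall i, 0 <= w i) -> 0 <= m -> forall i, 0 <= ext w m i.
  by move=> w0 m0 i; rewrite /ext; case: unlift.
have [[w w0 vE]|[a va ga]] := IHn g' v.
  left; exists (ext w 0); first exact: ext_ge0.
  by rewrite sum_ext scale0r addr0.
have [ha|ha] := leP (dot h a) 0.
  by right; exists a => //; apply: splitI.
have ha0 : dot h a != 0 by rewrite gt_eqF.
pose pr x := x - (dot x a / dot h a) *: h.
have [[w w0 vE]|[b vb gb]] := IHn (pr \o g') (pr v).
  left; pose wm := (dot v a - \sum_i w i * dot (g' i) a) / dot h a.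
  exists (ext w wm).
    apply: ext_ge0 => //.
    rewrite divr_ge0 ?(ltW ha) // subr_ge0 (le_trans _ (ltW va)) //.
    by rewrite sumr_le0 // => j _; rewrite mulr_ge0_le0.
  rewrite sum_ext.
  move/eqP: vE; rewrite subr_eq => /eqP->.
  rewrite /pr /= (eq_bigr (fun i => w i *: g' i -
    (w i * dot (g' i) a / dot h a) *: h)); last first.
    by move=> i _; rewrite scalerBr scalerA mulrA.
  by rewrite sumrB -scaler_suml -mulr_suml /wm mulrBl scalerBl addrAC addrA.
right; exists (b - (dot h b / dot h a) *: a).
  suff -> : dot v (b - (dot h b / dot h a) *: a) = dot (pr v) b by [].
  by rewrite dotBr dotZr dotBl dotZl; field.
apply: splitI => [i|]; last by rewrite -/h dotBr dotZr divfK // subrr.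
rewrite -/(g' i); have := gb i.
suff -> : dot (g' i) (b - (dot h b / dot h a) *: a) = dot (pr (g' i)) b by [].
by rewrite dotBr dotZr dotBl dotZl; field.
Qed.

Context {R : realType}.
Implicit Types (d : nat).

(** Appending a coordinate 1 turns affine forms into linear ones and the convex
hull into a slice of a cone, to which Farkas' lemma applies. *)
Lemma conv_separation d (s : seq 'rV[R]_d) (v : 'rV[R]_d) :
  ~ conv [set` s] v ->
  exists a c, (forall x, x \in s -> dot x a <= c) /\ c < dot v a.
Proof.
move=> vNs; pose p i := tnth (in_tuple s) i.
pose lft (x : 'rV[R]_d) : 'rV_(d + 1) := row_mx x 1%:M.
have [[w w0 vE]|[a va pa]] := farkas (lft \o p) (lft v).
  case: vNs; exists (size s), p, w; split=> //.
  - by move=> i; exact: mem_tnth.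
  - have /(congr1 (fun x => rsubmx x 0 0)) := vE.
    rewrite row_mxKr linear_sum summxE mxE eqxx mulr1n => ->.
    by apply: eq_bigr => i _; rewrite linearZ /= row_mxKr !mxE eqxx mulr1.
  - have /(congr1 lsubmx) := vE; rewrite row_mxKl linear_sum /= => ->.
    by apply: eq_bigr => i _; rewrite linearZ /= row_mxKl.
have lftE x : dot (lft x) a = dot x (usubmx a) + dsubmx a 0 0.
  by rewrite -[in LHS](vsubmxK a) mul_row_col mul1mx mxE.
exists (usubmx a), (- dsubmx a 0 0); split.
  move=> x /(tnthP (in_tuple s))[i ->].
  by rewrite -subr_le0 opprK -lftE; exact: pa.
by rewrite -subr_gt0 opprK -lftE.
Qed.

(** The weighted average of the numbers c - dot (p i) a, all nonnegative, is 0: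
only points on the supporting hyperplane carry weight. *)
Lemma conv_max_support d n (p : 'I_n -> 'rV[R]_d) (w : 'I_n -> R) a c :
  (forall i, 0 <= w i) -> \sum_i w i = 1 -> (forall i, dot (p i) a <= c) ->
  dot (\sum_i w i *: p i) a = c -> forall i, w i != 0 -> dot (p i) a = c.
Proof.
move=> w0 w1 pc mc i wi.
have : \sum_i w i * (c - dot (p i) a) = 0.
  rewrite (eq_bigr (fun i => w i * c - dot (w i *: p i) a)); last first.
    by move=> j _; rewrite mulrBr dotZl.
  by rewrite sumrB -dot_suml mc -mulr_suml w1 mul1r subrr.
move/psumr_eq0P => /(_ _ i isT) => /(_ _)/eqP.
rewrite mulf_eq0 (negPf wi) subr_eq0 /= => H.
by apply/esym/eqP/H => j _; rewrite mulr_ge0 // subr_ge0.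
Qed.

Lemma vertices_conv d (S : set 'rV[R]_d) : vertices (conv S) `<=` S.
Proof.
move=> v [a [c [le_c vF]]].
have : [set v] v by [].
rewrite vF => -[[n [p [w [Sp w0 w1 vE]]]] /= vc].
have [i wi] : exists i, w i != 0.
  apply/not_existsP => wN; move: w1; rewrite big1 => [/eqP|i _].
    by rewrite eq_sym oner_eq0.
  by apply/eqP/negP => /negP; exact: wN.
suff : [set v] (p i) by move=> /= <-.
rewrite vF; split=> /=; first exact: sub_conv.
apply: conv_max_support wi => //; last by rewrite -vE.
by move=> j; exact/le_c/sub_conv.
Qed.

(** A form that separates v from the other points attains its maximum over the
hull at v alone. *)
Lemma vertex_of_notin_conv d (s : seq 'rV[R]_d) (v : 'rV[R]_d) :
  v \in s -> ~ conv [set` [seq x <- s | x != v]] v ->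
  vertices (conv [set` s]) v.
Proof.
move=> vs /conv_separation[a [c [le_c c_lt]]].
have sle x : x \in s -> dot x a <= dot v a.
  move=> xs; have [->//|xv] := eqVneq x v.
  by rewrite (le_trans _ (ltW c_lt)) // le_c // mem_filter /= xv.
exists a, (dot v a); split.
  move=> x [n [p [w [Sp w0 w1 ->]]]].
  rewrite dot_suml -[leRHS]mul1r -w1 mulr_suml.
  by apply: ler_sum => i _; rewrite dotZl ler_wpM2l //; apply: sle; exact: Sp.
apply/seteqP; split=> [_ ->|x]; first by split=> //; exact: sub_conv.
move=> [[n [p [w [Sp w0 w1 ->]]]] /= mc].
rewrite -[RHS]scale1r -w1 scaler_suml; apply: eq_bigr => i _.
have [->|wi] := eqVneq (w i) 0; first by rewrite !scale0r.
congr (_ *: _); apply/eqP; apply: contraT => piv.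
have pia : dot (p i) a = dot v a.
  by apply: conv_max_support wi => // j; apply: sle; exact: Sp.
suff : dot (p i) a <= c by rewrite pia leNgt c_lt.
by apply: le_c; rewrite mem_filter /= piv; exact: Sp.
Qed.

(** Discard points that lie in the hull of the others until none is left: the
remaining points are all exposed. *)
Lemma conv_seq_vertices d (s : seq 'rV[R]_d) : exists s' : seq 'rV[R]_d,
  [set` s'] `<=` vertices (conv [set` s]) /\ conv [set` s'] = conv [set` s].
Proof.
have [n] := ubnP (size s); elim: n => // n IHn in s *; rewrite ltnS => sn.
have [[v [vs vconv]]|Nred] :=
  pselect (exists v, v \in s /\ conv [set` [seq x <- s | x != v]] v).
  have convs : conv [set` s] = conv [set` [seq x <- s | x != v]].
    apply: conv_absorb => x /=; first by rewrite mem_filter => /andP[].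
    move=> xs; have [->//|xv] := eqVneq x v.
    by apply: sub_conv; rewrite /= mem_filter /= xv.
  rewrite convs; apply: IHn; apply: leq_trans sn.
  rewrite size_filter -(count_predC (fun x => x != v) s) -[X in (X < _)%N]addn0.
  by rewrite ltn_add2l -has_count; apply/hasP; exists v => //=; rewrite negbK.
exists s; split=> // v vs; apply: vertex_of_notin_conv => // vconv.
by apply: Nred; exists v.
Qed.

End Separation.
(** * Systems of linear forms on a subspace *)

Section Columns.
Variables (F : fieldType) (D : nat).
Implicit Types (m : nat -> 'cV[F]_D) (W : {vspace 'rV[F]_D}).

Definition cols m k : 'M[F]_(D, k) := \matrix_(i, j) m j i 0.

Lemma mul_cols m k (x : 'rV[F]_D) j : (x *m cols m k) 0 j = dot x (m j).
Proof. by rewrite !mxE; apply: eq_bigr => i _; rewrite !mxE. Qed.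

Lemma mul_cols_eq0 m k (x : 'rV[F]_D) :
  x *m cols m k = 0 <-> forall j, (j < k)%N -> dot x (m j) = 0.
Proof.
split=> [x0 j jk|x0]; first by rewrite -(mul_cols m x (Ordinal jk)) x0 mxE.
by apply/rowP => j; rewrite mul_cols x0 // mxE.
Qed.

Definition inj_on W k (M : 'M[F]_(D, k)) :=
  forall v, v \in W -> v *m M = 0 -> v = 0.

Lemma dim_image W k (M : 'M[F]_(D, k)) :
  inj_on W M -> \dim (linfun (mulmxr M) @: W) = \dim W.
Proof.
move=> Minj; apply: limg_dim_eq; apply/eqP; rewrite -subv0.
apply/subvP => v; rewrite memv_cap memv_ker memv0 lfunE /=.
by move=> /andP[vW /eqP/(Minj _ vW)->].
Qed.

Lemma inj_on_onto W k (M : 'M[F]_(D, k)) : \dim W = k -> inj_on W M ->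
  forall z, exists2 v, v \in W & v *m M = z.
Proof.
move=> Wk Minj z.
have : z \in (linfun (mulmxr M) @: W)%VS.
  suff -> : (linfun (mulmxr M) @: W)%VS = fullv by rewrite memvf.
  apply/eqP; rewrite eqEdim subvf dimvf /= dim_image // Wk.
  by rewrite /dim /= mul1n.
by move=> /memv_imgP[v vW ->]; exists v; rewrite ?lfunE.
Qed.

(** If the columns of M are injective on W, then as forms on W they are a basis
of its dual, so every form is a combination of them on W. *)
Lemma functional_factor W (M : 'M[F]_(D, \dim W)) (a : 'cV[F]_D) :
  inj_on W M -> exists c, forall v, v \in W -> v *m a = v *m M *m c.
Proof.
move=> Minj; pose B := \matrix_i (vbasis W)`_i : 'M_(\dim W, D).
have BE (r : 'rV_(\dim W)) : r *m B = \sum_i r 0 i *: (vbasis W)`_i.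
  by rewrite mulmx_sum_row; apply: eq_bigr => i _; rewrite rowK.
have BMu : B *m M \in unitmx.
  rewrite -row_free_unit; apply: inj_row_free => r; rewrite mulmxA => rBM.
  have rB : r *m B = 0.
    apply: Minj rBM; rewrite BE memv_suml // => i _.
    by rewrite memvZ // vbasis_mem // mem_nth // size_tuple.
  apply/rowP => i; rewrite mxE.
  have /freeP := basis_free (vbasisP W); apply.
  by rewrite -BE.
exists (invmx (B *m M) *m (B *m a)) => v vW.
pose r := \row_i coord (vbasis W) i v.
have -> : v = r *m B.
  rewrite BE {1}(coord_vbasis vW); apply: eq_bigr => i _.
  by rewrite mxE.
by rewrite -(mulmxA r B M) -[RHS]mulmxA mulKVmx // mulmxA.
Qed.

End Columns.

(** * Rational forms in general position *)

Section Generic.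
Variables (R : realType) (D : nat).

Local Notation "A ^Q" := (map_mx (@ratr R) A) (at level 2).

(** Points (1, t, t^2, ...) of the moment curve: v becomes a nonzero polynomial
in t, and t need only avoid the roots of finitely many of these. *)
Lemma generic_vector (vs : seq 'rV[R]_D) : 0 \notin vs ->
  exists a : 'cV[rat]_D, forall v, v \in vs -> dot v a^Q != 0.
Proof.
move=> vs0; pose p := \prod_(v <- vs) rVpoly v.
have p0 : p != 0.
  rewrite prodf_seq_neq0; apply/allP => v vin /=.
  apply: contraNneq vs0 => v0; rewrite (_ : 0 = v) //.
  by rewrite -(rVpolyK v) v0 linear0.
have [t pt] : exists t : nat, ~~ root p t%:R.
  apply/not_existsP => H.
  suff : (size [seq t%:R : R | t <- iota 0 (size p)] < size p)%N.
    by rewrite size_map size_iota ltnn.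
  apply: (max_poly_roots p0).
    by apply/allP => _ /mapP[t _ ->]; apply/negPn/negP; exact: H.
  rewrite map_inj_uniq ?iota_uniq // => x y /eqP; rewrite eqr_nat.
  by move/eqP.
exists (\col_i t%:R ^+ i) => v vin; apply: contraNneq pt => vt.
rewrite /root horner_prod prodf_seq_eq0; apply/hasP; exists v => //=.
rewrite (@horner_coef_wide _ D) ?size_poly //.
rewrite mxE in vt; rewrite -[X in _ == X]vt; apply/eqP/eq_bigr => i _.
by rewrite !mxE rmorphXn /= ratr_nat coef_rVpoly_ord.
Qed.

(** Induction on a bound for the dimensions: the first form is chosen not to
vanish identically on any of the nonzero subspaces, the following ones are
generic for the intersections of these subspaces with its kernel, whose
dimensions are smaller. *)
Lemma generic_columns (Ws : seq {vspace 'rV[R]_D}) :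
  exists m : nat -> 'cV[rat]_D, forall W, W \in Ws ->
    inj_on W (cols (fun j => (m j)^Q) (\dim W)).
Proof.
suff: exists m : nat -> 'cV[rat]_D, forall W, W \in Ws ->
    forall v, v \in W -> (forall j, (j < \dim W)%N -> dot v (m j)^Q = 0) ->
    v = 0.
  move=> [m mP]; exists m => W WWs v vW /mul_cols_eq0; exact: mP WWs v vW.
have [n] : exists n, forall W, W \in Ws -> (\dim W <= n)%N.
  by exists (\dim {:'rV[R]_D})%N => W _; apply/dimvS/subvf.
elim: n Ws => [|n IHn] Ws dimWs.
  exists (fun=> 0) => W /dimWs; rewrite leqn0 dimv_eq0 => /eqP-> v.
  by rewrite memv0 => /eqP.
have [|a aP] := @generic_vector [seq vpick W | W <- Ws & W != 0%VS].
  apply/negP => /mapP[W]; rewrite mem_filter -vpick0 => /andP[+ _] W0.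
  by rewrite -W0 eqxx.
pose cut W := (W :&: lker (linfun (mulmxr a^Q)))%VS : {vspace 'rV[R]_D}.
have cut_lt W : W \in Ws -> W != 0%VS -> (\dim (cut W) < \dim W)%N.
  move=> WWs W0; rewrite ltn_neqAle dimvS ?capvSl // andbT.
  apply/negP => dimE; have /eqP cutE : cut W == W.
    by rewrite eqEdim capvSl (eqP dimE) /=.
  have := memv_pick W; rewrite -{2}cutE memv_cap memv_ker lfunE /= => /andP[_].
  move/eqP/matrixP/(_ 0 0); rewrite [RHS]mxE; apply/eqP/aP.
  by apply/mapP; exists W => //; rewrite mem_filter W0.
have cut0 W : W = 0%VS -> cut W = 0%VS by move=> ->; exact: cap0v.
have [|m mP] := IHn (map cut Ws).
  move=> _ /mapP[W WWs ->].
  have [/cut0->|W0] := eqVneq W 0%VS; first by rewrite dimv0.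
  by rewrite -ltnS (leq_trans (cut_lt _ WWs W0)) // dimWs.
exists (fun j => if j is j'.+1 then m j' else a) => W WWs v vW v0.
have [W0|W0] := eqVneq W 0%VS; first by move: vW; rewrite W0 memv0 => /eqP.
apply: (mP (cut W)); first exact: map_f.
  rewrite memv_cap vW memv_ker lfunE /=; apply/eqP/matrixP => i j.
  by rewrite !ord1 [RHS]mxE; apply: (v0 0%N); rewrite lt0n dimv_eq0.
by move=> j jcut; apply: (v0 j.+1); exact: leq_ltn_trans (cut_lt _ WWs W0).
Qed.

(** Solvability is an inclusion of row spaces, hence a statement about ranks,
which do not change under field extension. *)
Lemma rational_solution n k (A : 'M[rat]_(n, k)) (b : 'cV[rat]_n)
    (c : 'cV[R]_k) :
  A^Q *m c = b^Q -> exists c', A *m c' = b.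
Proof.
move=> Ac; have : (b^T <= A^T)%MS.
  rewrite -(map_submx (@ratr R)) -!map_trmx -Ac trmx_mul.
  exact: submxMl.
by case/submxP => c' bE; exists c'^T; rewrite -[A]trmxK -trmx_mul -bE trmxK.
Qed.

(** The forms m 0, ..., m (k-1) are coordinates on the flat, so m k is an affine
function of them.  Evaluated at the points of s this is a linear system with
rational data for the coefficients, so they may be taken rational; the relation
then extends from the points to the flat they span. *)
Lemma affine_relation (s : seq 'rV[rat]_D) x0 (W : {vspace 'rV[R]_D})
    (m : nat -> 'cV[rat]_D) :
  let M := cols m (\dim W) in
  aff [set` [seq x^Q | x <- s]] = [set x | x - x0 \in W] -> inj_on W M^Q ->
  exists (q0 : 'M[rat]_1) (q : 'cV[rat]_(\dim W)), forall x,
    aff [set` [seq x^Q | x <- s]] x ->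
    x *m (m (\dim W))^Q = q0^Q + x *m M^Q *m q^Q.
Proof.
move=> M affE Minj; set k := \dim W in M Minj *.
have [c cP] := functional_factor (m k)^Q Minj.
pose y i := tnth (in_tuple s) i.
pose A : 'M[rat]_(size s, 1 + k) := \matrix_i row_mx 1%:M (y i *m M).
pose b : 'cV[rat]_(size s) := \matrix_i (y i *m m k).
pose c0 := x0 *m (m k)^Q - x0 *m M^Q *m c.
have /rational_solution[c' c'P] : A^Q *m col_mx c0 c = b^Q.
  apply/row_matrixP => i; rewrite row_mul -!map_row !rowK map_row_mx.
  rewrite !map_mxM /= map_mx1 mul_row_col mul1mx.
  have yW : (y i)^Q - x0 \in W.
    suff : [set x | x - x0 \in W] (y i)^Q by [].
    by rewrite -affE; apply: sub_aff; apply: map_f; exact: mem_tnth.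
  have := cP _ yW; rewrite !mulmxBl => /eqP.
  by rewrite subr_eq /c0 => /eqP->; rewrite addrC addrA addrAC.
exists (usubmx c'), (dsubmx c') => _ [n [p [w [Sp w1 ->]]]].
have pE i : p i *m (m k)^Q = (usubmx c')^Q + p i *m M^Q *m (dsubmx c')^Q.
  have /mapP[_ /(tnthP (in_tuple s))[j ->] ->] := Sp i.
  rewrite -!map_mxM -map_mxD; congr (_ ^Q).
  have /(congr1 (row j)) := c'P.
  by rewrite row_mul !rowK -{1}(vsubmxK c') mul_row_col mul1mx => <-.
rewrite !mulmx_suml -[X in X + _]scale1r -w1 scaler_suml -big_split /=.
by apply: eq_bigr => i _; rewrite -!scalemxAl pE scalerDr.
Qed.

Lemma clear_denominators (s : seq rat) :
  exists2 N : nat, (0 < N)%N & forall q, q \in s -> N%:R * q \is a Num.int.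
Proof.
elim: s => [|q s [N N0 NP]]; first by exists 1%N.
exists (N * `|denq q|)%N; first by rewrite muln_gt0 N0 absz_gt0 denq_neq0.
move=> r; rewrite inE => /predU1P[->|/NP rint].
  rewrite natrM -mulrA rpredM ?natr_int //.
  rewrite -[_%:R]/(`|denq q|%N%:~R) absz_denq mulrC -numqE.
  exact: intr_int.
by rewrite natrM mulrAC rpredM ?natr_int.
Qed.

Lemma flat_direction_unique (x0 x1 : 'rV[R]_D) (W W' : {vspace 'rV[R]_D}) :
  [set x | x - x0 \in W] = [set x | x - x1 \in W'] -> W = W'.
Proof.
have sub (y0 y1 : 'rV[R]_D) (V V' : {vspace 'rV[R]_D}) :
    [set x | x - y0 \in V] = [set x | x - y1 \in V'] -> (V <= V')%VS.
  move=> E; apply/subvP => v vV.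
  have in0 : [set x | x - y1 \in V'] y0 by rewrite -E /= subrr mem0v.
  have inv : [set x | x - y1 \in V'] (v + y0) by rewrite -E /= addrK.
  have := memvB inv in0; by rewrite opprB addrA subrK addrK.
by move=> E; apply/eqP; rewrite eqEsubv (sub _ _ _ _ E) (sub _ _ _ _ (esym E)).
Qed.

End Generic.
(** * Lattice coordinates *)

Section LatticeCoordinates.
Context {R : realType} {D : nat}.
Implicit Types (V U : set 'rV[R]_D) (W : {vspace 'rV[R]_D}).

(** A condition on every flat spanned by points of V.  With k the dimension of
the flat, the two clauses say that the first k coordinates parametrize it and
that the coordinate of index k is integral wherever those are.  For k = 0 the
latter is integrality of the first coordinate on V. *)
Definition lattice_coordinates V (m : nat -> 'cV[R]_D) :=
  forall U x0 W, U `<=` V -> aff U = [set x | x - x0 \in W] ->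
  inj_on W (cols m (\dim W)) /\
  forall x, aff U x -> x *m cols m (\dim W) \is a mxOver Num.int ->
    dot x (m (\dim W)) \is a Num.int.

Local Notation "A ^Q" := (map_mx (@ratr R) A) (at level 2).

Lemma map_cols (m : nat -> 'cV[rat]_D) k :
  (cols m k)^Q = cols (fun j => (m j)^Q) k.
Proof. by apply/matrixP => i j; rewrite !mxE. Qed.

(** The subsets of a finite set of points are finite in number, hence so are the
direction spaces to be made generic and the rational coefficients whose
denominators are to be cleared. *)
Lemma exists_lattice_coordinates (s : seq 'rV[rat]_D) :
  exists m, lattice_coordinates [set` [seq x^Q | x <- s]] m.
Proof.
pose sub (I : {set 'I_(size s)}) := [seq tnth (in_tuple s) i | i <- enum I].
pose pts (I : {set 'I_(size s)}) : set 'rV[R]_D :=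
  [set` [seq x^Q | x <- sub I]].
have ptsP U : U `<=` [set` [seq x^Q | x <- s]] -> exists I, U = pts I.
  move=> Us; exists [set i | `[< U (tnth (in_tuple s) i)^Q >]]%SET.
  apply/seteqP; split => [x Ux|_ /mapP[_ /mapP[i + ->] ->]]; last first.
    by rewrite mem_enum inE => /asboolP.
  have /mapP[y /(tnthP (in_tuple s))[i yE] xE] := Us _ Ux.
  rewrite /= xE yE; apply: map_f; apply: map_f.
  by rewrite mem_enum inE; apply/asboolP; rewrite -yE -xE.
(* A flat determines its direction space, so each subset contributes one
   space and one list of coefficients. *)
have [dir dirP] : exists dir, forall I x0 W,
    aff (pts I) = [set x | x - x0 \in W] -> W = dir I.
  suff H I : exists W', forall x0 W,
      aff (pts I) = [set x | x - x0 \in W] -> W = W'.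
    by have [dir dirP] := choice H; exists dir.
  have [[x1 [W' E']]|N] :=
    pselect (exists x1 W', aff (pts I) = [set x | x - x1 \in W']).
    by exists W' => x0 W E; apply: (@flat_direction_unique _ _ x0 x1);
      rewrite -E -E'.
  by exists 0%VS => x0 W E; case: N; exists x0, W.
have [m mP] := generic_columns (codom dir).
have Minj I x0 W : aff (pts I) = [set x | x - x0 \in W] ->
    inj_on W (cols m (\dim W))^Q.
  move=> /dirP->; rewrite map_cols; apply: mP.
  exact: codom_f.
pose rel I (t : seq rat) W := exists (q0 : 'M[rat]_1) (q : 'cV[rat]_(\dim W)),
  [/\ q0 0 0 \in t, forall j, q j 0 \in t & forall x, aff (pts I) x ->
   x *m (m (\dim W))^Q = q0^Q + x *m (cols m (\dim W))^Q *m q^Q].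
have [qs qsP] : exists qs, forall I x0 W,
    aff (pts I) = [set x | x - x0 \in W] -> rel I (qs I) W.
  suff H I : exists t, forall x0 W,
      aff (pts I) = [set x | x - x0 \in W] -> rel I t W.
    by have [qs qsP] := choice H; exists qs.
  have [[x1 [W' E']]|N] :=
    pselect (exists x1 W', aff (pts I) = [set x | x - x1 \in W']); last first.
    by exists [::] => x0 W E; case: N; exists x0, W.
  have [q0 [q qP]] := affine_relation E' (Minj _ _ _ E').
  exists (q0 0 0 :: [seq q j 0 | j <- enum 'I_(\dim W')]) => x0 W E.
  rewrite (dirP _ _ _ E) -(dirP _ _ _ E').
  exists q0, q; split=> [|j|//]; first exact: mem_head.
  by rewrite in_cons; apply/orP; right; apply: (map_f (fun j => q j 0));
    rewrite mem_enum.
have [N N0 NP] :=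
  clear_denominators (flatten (codom qs)).
have Nint I q : q \in qs I -> N%:R * ratr q \is a @Num.int R.
  move=> qin; rewrite -ratr_nat -rmorphM /=.
  have /intrP[z ->] : N%:R * q \is a Num.int.
    by apply/NP/flattenP; exists (qs I) => //; exact: codom_f.
  by rewrite ratr_int intr_int.
(* The exponents grow with j so that N divides the ratio of the scale of m k
   to the scale of any earlier m j. *)
exists (fun j => N%:R ^+ j.+1 *: (m j)^Q) => U x0 W /ptsP[I ->] affE.
have NE j : N%:R ^+ j != 0 :> R by rewrite expf_neq0 // pnatr_eq0 -lt0n.
split.
  move=> v vW /mul_cols_eq0 v0; apply: (Minj _ _ _ affE) => //.
  rewrite map_cols; apply/mul_cols_eq0 => j jk.
  by apply/eqP; have /eqP := v0 j jk; rewrite dotZr mulf_eq0 (negPf (NE _)).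
move=> x xU; set k := \dim W => /mxOverP xint.
have [q0 [q [q0in qin /(_ x xU) xE]]] := qsP _ _ _ affE.
rewrite dotZr xE mxE mulrDr rpredD //.
  by rewrite mxE exprSr -mulrA rpredM ?rpredX ?natr_int // (Nint I).
rewrite mxE mulr_sumr rpred_sum // => j _.
rewrite map_cols mul_cols [q^Q _ _]mxE.
have -> : N%:R ^+ k.+1 * (dot x (m j)^Q * ratr (q j 0)) =
    (N%:R ^+ (k - j.+1) * (N%:R * ratr (q j 0))) *
      dot x (N%:R ^+ j.+1 *: (m j)^Q).
  have -> : N%:R ^+ k.+1 = N%:R ^+ (k - j.+1) * N%:R * N%:R ^+ j.+1 :> R.
    by rewrite -exprSr -exprD addSn subnK.
  by rewrite dotZr; ring.
rewrite rpredM //; first by rewrite rpredM ?rpredX ?natr_int // (Nint I).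
by have := xint 0 j; rewrite mul_cols.
Qed.

End LatticeCoordinates.

(** * Lattice-face polytopes from lattice coordinates *)

Section LatticeFace.
Context {R : realType}.

Lemma forget_last_cols D (m : nat -> 'cV[R]_D) d (x : 'rV[R]_D) :
  forget_last (x *m cols m d.+1) = x *m cols m d.
Proof. by apply/rowP => j; rewrite mxE !mul_cols. Qed.

Lemma aff_image_flat D (U : set 'rV[R]_D) d (M : 'M[R]_(D, d)) x0
    (W : {vspace 'rV[R]_D}) :
  aff U = [set x | x - x0 \in W] ->
  aff ((fun x => x *m M) @` U) =
  [set z | z - x0 *m M \in (linfun (mulmxr M) @: W)%VS].
Proof.
move=> affE; rewrite -aff_image affE; apply/seteqP; split=> [_ [x xW <-]|z] /=.
  by rewrite -mulmxBl; apply/memv_imgP; exists (x - x0); rewrite ?lfunE.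
move=> /memv_imgP[v vW]; rewrite lfunE /= => zE.
by exists (v + x0); rewrite ?addrK // mulmxDl -zE subrK.
Qed.

Lemma polytope_image D (U : set 'rV[R]_D) d (M : 'M[R]_(D, d)) x0
    (W : {vspace 'rV[R]_D}) :
  finite_set U -> aff U = [set x | x - x0 \in W] -> \dim W = d -> inj_on W M ->
  polytope ((fun x => x *m M) @` conv U).
Proof.
move=> finU affU dimW Minj; rewrite conv_image; split.
  by eexists; last by []; exact: finite_image.
rewrite aff_conv (aff_image_flat _ affU).
by eexists; eexists; split; last by []; rewrite dim_image.
Qed.

(** Induction on the dimension, with the original space fixed: forgetting the
last coordinate only drops the last form.  A set U' of vertices of the image of
U is the image of a subset T of U, and since the forms are injective on the flat
of U, the flats of T and U' have the same dimension.  The first clause of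
[lattice_coordinates] for T then gives a unique point of its flat above each
integral point of the hyperplane of the first coordinates, and the second makes
its last coordinate integral. *)
Lemma lattice_face_cols D (V : set 'rV[R]_D) m :
  finite_set V -> lattice_coordinates V m ->
  forall d U, U `<=` V -> affine_space d.+1 (aff U) ->
  lattice_face ((fun x => x *m cols m d.+1) @` conv U).
Proof.
move=> finV mP; elim=> [|d IHd] U UV [x0 [W [dimW affU]]];
  have [Minj _] := mP _ _ _ UV affU; rewrite dimW in Minj;
  (split; first exact: polytope_image (sub_finite_set UV finV) affU dimW Minj);
  rewrite conv_image.
  move=> v /vertices_conv[x Ux <-].
  (* In dimension 1 the integrality condition is used for the 0-dimensional
     flat formed by the vertex itself. *)
  have x1U : [set x] `<=` V by move=> _ ->; exact: UV.
  have affx : aff [set x] = [set y | y - x \in 0%VS].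
    apply/seteqP; split=> [_ [n [p [w [px w1 ->]]]]|y] /=.
      rewrite (eq_bigr (fun i => w i *: x)) => [|i _]; last by rewrite px.
      by rewrite -scaler_suml w1 scale1r subrr mem0v.
    by rewrite memv0 subr_eq0 => /eqP->; exact: sub_aff.
  have [_] := mP _ _ _ x1U affx; rewrite dimv0 => /(_ x) xint.
  apply/mxOverP => i j; rewrite !ord1 mul_cols; apply: xint;
    first exact: sub_aff.
  by apply/mxOverP => ? [].
move=> U' U'vert [y0 [W' [dimW' affU']]].
pose f (x : 'rV[R]_D) := x *m cols m d.+2.
pose T := [set x | U x /\ U' (f x)].
have TU : T `<=` U by move=> x [].
have fT : f @` T = U'.
  apply/seteqP; split=> [_ [x [_ fx] <-] //|z U'z].
  by have [x Ux fx] := vertices_conv (U'vert _ U'z); exists x => //;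
    split=> //; rewrite /f fx.
have affT : f @` aff T = aff U' by rewrite aff_image fT.
have affTU : aff T `<=` aff U by rewrite !affE; exact: hull_mono.
have [t0 Tt0] : exists t0, aff T t0.
  have : aff U' y0 by rewrite affU' /= subrr mem0v.
  by rewrite -affT => -[t0 ? _]; exists t0.
pose W'' := (W :&: (linfun (mulmxr (cols m d.+2)) @^-1: W'))%VS.
have in_dir E (c y z : 'rV[R]_E) (X : {vspace 'rV[R]_E}) :
    y - c \in X -> z - c \in X -> y - z \in X.
  by move=> yX zX; have := memvB yX zX; rewrite opprB addrA subrK.
have affUP x : aff U x <-> x - x0 \in W by rewrite affU.
have affU'P z : aff U' z <-> z - y0 \in W' by rewrite affU'.
have affTU' x : aff T x -> aff U' (f x) by rewrite -affT => Tx; exists x.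
have affTE : aff T = [set x | x - t0 \in W''].
  apply/seteqP; split=> x /=.
    move=> Tx; rewrite memv_cap -memv_preim lfunE /= mulmxBl; apply/andP; split.
      by apply: in_dir; apply/affUP/affTU.
    by apply: in_dir; apply/affU'P/affTU'.
  rewrite memv_cap -memv_preim lfunE /= => /andP[xW fxW'].
  have : aff U' (f x).
    apply/affU'P; rewrite -(subrK (f t0) (f x)) -addrA /f -mulmxBl.
    by rewrite memvD //; apply/affU'P/affTU'.
  rewrite -affT => -[x' Tx' fx'].
  suff -> : x = x' by [].
  apply/subr0_eq/Minj; last first.
    by apply/eqP; rewrite mulmxBl subr_eq0 eq_sym; apply/eqP.
  rewrite -(subrK t0 x) -addrA memvD // (in_dir _ x0) //;
    apply/affUP; exact: affTU.
have dimW'' : \dim W'' = d.+1.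
  rewrite -(dim_image (M := cols m d.+2)); last first.
    by move=> v /(subvP (capvSl _ _)); exact: Minj.
  rewrite -[RHS]dimW'; congr (\dim _); apply/vspaceP => z; apply/idP/idP.
    by move=> /memv_imgP[v + ->]; rewrite memv_cap -memv_preim => /andP[].
  move=> zW'; have [v vW vz] := inj_on_onto dimW Minj z.
  by apply/memv_imgP; exists v;
    rewrite ?memv_cap -?memv_preim ?lfunE /= ?vz ?vW.
have TV : T `<=` V by exact: subset_trans UV.
have [Tinj Tint] := mP _ _ _ TV affTE; rewrite dimW'' in Tinj Tint.
split.
  suff -> : @forget_last R d.+1 @` conv U' =
      (fun x => x *m cols m d.+1) @` conv T.
    by apply: IHd => //; exists t0, W''.
  rewrite -fT -conv_image image_comp.
  by apply: eq_imagel => x _ /=; rewrite forget_last_cols.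
apply/seteqP; split=> [_ [x [_ /mxOverP xint] <-]|z [_ /= /mxOverP zint]].
  by split=> //=; apply/mxOverP => i j; rewrite mxE; exact: xint.
have [v vW'' vz] := inj_on_onto dimW'' Tinj (z - t0 *m cols m d.+1).
have Tx : aff T (v + t0) by rewrite affTE /= addrK.
have xz : (v + t0) *m cols m d.+1 = z by rewrite mulmxDl vz subrK.
exists (f (v + t0)); last by rewrite forget_last_cols.
split; first by rewrite -affT; exists (v + t0).
apply/mxOverP => i j; rewrite ord1 mul_cols.
have [->|jd] := eqVneq (j : nat) d.+1.
  by apply: Tint => //; rewrite xz; apply/mxOverP.
have jlt : (j < d.+1)%N by rewrite ltn_neqAle jd -ltnS ltn_ord.
rewrite -(mul_cols m _ (Ordinal jlt)) xz; exact: zint.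
Qed.

End LatticeFace.
(** * Combinatorial type, and rational points *)

Section Conclusion.
Context {R : realType} {d : nat}.

Lemma image_supporting_slice (M : 'M[R]_d) (P : set 'rV[R]_d) a c :
  (fun x => x *m M) @` (P `&` [set x | dot x (M *m a) = c]) =
  (fun x => x *m M) @` P `&` [set x | dot x a = c].
Proof.
apply/seteqP; split=> [_ [x [Px /= xc] <-]|_ [[x Px <-] /= xc]].
  by split; [exists x | rewrite /= -mulmxA].
by exists x => //; split=> //=; rewrite mulmxA.
Qed.

(** The form a on the image is the form M *m a on P, so supporting hyperplanes
correspond. *)
Lemma same_combinatorial_type_image (M : 'M[R]_d) (P : set 'rV[R]_d) :
  M \in unitmx -> same_combinatorial_type P ((fun x => x *m M) @` P).
Proof.
move=> Mu; pose f (x : 'rV[R]_d) := x *m M.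
have finj : injective f by exact: can_inj (mulmxK Mu).
have sub F G : f @` F `<=` f @` G -> F `<=` G.
  by move=> FG x Fx; have [y Gy /finj<-] := FG _ (imageP f Fx).
exists (fun F => f @` F); split; last first.
  by move=> F G _ _; split=> [|/sub//]; exact: image_subset.
split=> [F [a [c [ac ->]]]|F G _ _ FG|G [a [c [ac ->]]]].
- have aE : a = M *m (invmx M *m a) by rewrite mulKVmx.
  rewrite {1}aE image_supporting_slice; exists (invmx M *m a), c; split=> //.
  by move=> _ [x Px <-]; rewrite /f -mulmxA -aE; exact: ac.
- by apply/seteqP; split; apply: sub; rewrite FG.
- exists (P `&` [set x | dot x (M *m a) = c]).
    exists (M *m a), c; split=> // x Px.
    by rewrite mulmxA; apply: ac; exists x.
  exact: image_supporting_slice.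
Qed.

Lemma rational_seq (s : seq 'rV[R]_d) :
  (forall v, v \in s -> forall j, exists q : rat, v 0 j = ratr q) ->
  exists t : seq 'rV[rat]_d, s = [seq map_mx (@ratr R) x | x <- t].
Proof.
elim: s => [|v s IHs] rats; first by exists [::].
have [t ->] : exists t : seq 'rV[rat]_d, s = [seq map_mx (@ratr R) x | x <- t].
  by apply: IHs => u us; apply: rats; rewrite in_cons us orbT.
have [y yE] := choice (rats v (mem_head v s)).
exists ((\row_j y j) :: t) => /=; congr (_ :: _).
by apply/rowP => j; rewrite !mxE yE.
Qed.

End Conclusion.

Theorem theorem1p2 (R : realType) (d : nat) (d_gt0 : (0 < d)%N)
    (P : set 'rV[R]_d) (ratP : rational_polytope P) :
  (exists Q : set 'rV[R]_d, lattice_face Q /\ same_combinatorial_type P Q) /\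
  (exists phi : {linear 'rV[R]_d -> 'rV[R]_d},
     bijective phi /\ lattice_face (phi @` P)).
Proof.
suff [M [Mu Mface]] : exists M : 'M[R]_d,
    M \in unitmx /\ lattice_face ((fun x => x *m M) @` P).
  split; first by exists ((fun x => x *m M) @` P); split=> //;
    exact: same_combinatorial_type_image.
  exists (mulmxr M : {linear _ -> _}); split=> //.
  exact: (Bijective (mulmxK Mu) (mulmxKV Mu)).
case: d d_gt0 P ratP => // d _ P [[[V /finite_seqP[s0 ->] PE] dimP] ratP].
have [s [svert sconv]] := conv_seq_vertices s0.
have [t tE] : exists t : seq 'rV[rat]_d.+1,
    s = [seq map_mx (@ratr R) x | x <- t].
  by apply: rational_seq => v vs; apply: ratP; rewrite PE; exact: svert.
have [m] := @exists_lattice_coordinates R _ t; rewrite -tE => mP.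
move: dimP; rewrite PE -sconv aff_conv => dimS.
exists (cols m d.+1); split; last first.
  by apply: (lattice_face_cols _ mP) dimS => //; exact: finite_seq.
have [x0 [W [dimW affS]]] := dimS.
have [Minj _] := mP _ _ _ (@subset_refl _ _) affS; rewrite dimW in Minj.
rewrite -row_free_unit; apply: inj_row_free => v; apply: Minj.
suff -> : W = fullv by exact: memvf.
by apply/eqP; rewrite eqEdim subvf dimvf dimW /dim /= mul1n.
Qed.
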